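(* Let $A\in\mathbb{C}^{n\times n}$ be non-Hermitian positive definite with a multisplitting $(M_k,N_k,E_k)_{k=1}^m$ such that $E_k=\beta_k I$ and $A=M_k-N_k$ is an extended $P$-regular splitting for all $k=1,2,\dots,m$. Then, for every $b\in\mathbb{C}^n$, the parallel multisplitting iteration converges to the unique solution of $Ax=b$ for any choice of the initial guess $x^{(0)}\in\mathbb{C}^n$.
   Context: A (possibly non-Hermitian) matrix $X\in\mathbb{C}^{n\times n}$ is called positive definite if its Hermitian part $(X+X^* )/2$ is Hermitian positive definite, where $X^*$ is the conjugate transpose. A non-Hermitian positive definite matrix is a non-Hermitian matrix that is positive definite in this sense. A multisplitting of $A$ is a collection of triples of $n\times n$ matrices $(M_k,N_k,E_k)_{k=1}^m$ such that $A=M_k-N_k$ with $M_k$ nonsingular for $k=1,\dots,m$, and the $E_k$ are diagonal matrices with nonnegative entries satisfying $\sum_{k=1}^m E_k=I$. When $E_k=\beta_k I$, the $\beta_k$ are thus nonnegative scalars with $\sum_{k=1}^m\beta_k=1$. A splitting $A=M-N$ with $M$ nonsingular is an extended $P$-regular splitting if the matrix $M^*(A^{-1})^*A+N$ is positive definite (i.e., the Hermitian part of this possibly non-Hermitian matrix is Hermitian positive definite). The parallel multisplitting iteration for $Ax=b$: given $x^{(0)}$, for $i=0,1,2,\dots$ solve $M_k y_k=N_k x^{(i)}+b$ for $k=1,\dots,m$ and set $x^{(i+1)}=\sum_{k=1}^m E_k y_k$. *)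

(* Defs.v *)
From HB Require Import structures.
From mathcomp Require Import all_boot all_order all_algebra.
From mathcomp Require Import complex.
From mathcomp Require Import all_classical all_reals all_analysis.

Set Implicit Arguments.
Unset Strict Implicit.
Unset Printing Implicit Defensive.

Import Order.TTheory GRing.Theory Num.Theory.
Import numFieldNormedType.Exports.

Local Open Scope ring_scope.
Local Open Scope sesquilinear_scope.
Local Open Scope complex_scope.

(* MathComp-Analysis puts the metric topology of a numFieldType on its regular
   module; it is transferred here to the concrete type R[i], so that the
   matrices over R[i] inherit the entrywise topology. *)
HB.instance Definition _ (R : realType) :=
  PseudoPointedMetric.copy R[i] (R[i])^o.

Section Definitions.
Context {C : numClosedFieldType}.

(* In a numClosedFieldType, 0 < z and 0 <= z entail that z is real. *)
Definition hermitian_posdef n (H : 'M[C]_n) : Prop :=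
  H \is hermsymmx /\
  forall x : 'cV[C]_n, x != 0 -> 0 < (x^t* *m H *m x) 0 0.

Definition hermitian_part n (X : 'M[C]_n) : 'M[C]_n :=
  2^-1 *: (X + X^t*).

Definition posdef n (X : 'M[C]_n) : Prop := hermitian_posdef (hermitian_part X).

Definition nonhermitian_posdef n (X : 'M[C]_n) : Prop :=
  X \isn't hermsymmx /\ posdef X.

Definition multisplitting n m (A : 'M[C]_n) (M N E : 'I_m -> 'M[C]_n) : Prop :=
  [/\ forall k, A = M k - N k,
      forall k, M k \in unitmx,
      forall k, is_diag_mx (E k),
      forall k i j, 0 <= E k i j
    & \sum_k E k = 1%:M].

Definition extended_P_regular_splitting n (A M N : 'M[C]_n) : Prop :=
  [/\ A = M - N, M \in unitmx
    & posdef (M^t* *m (invmx A)^t* *m A + N)].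

Definition parallel_multisplitting_iteration n m (M N E : 'I_m -> 'M[C]_n)
    (b x0 : 'cV[C]_n) (x : nat -> 'cV[C]_n) : Prop :=
  x 0%N = x0 /\
  forall i, exists y : 'I_m -> 'cV[C]_n,
    (forall k, M k *m y k = N k *m x i + b) /\ x i.+1 = \sum_k E k *m y k.

Lemma parallel_multisplitting_iteration_exists n m
    (M N E : 'I_m -> 'M[C]_n) (b x0 : 'cV[C]_n) :
  (forall k, M k \in unitmx) ->
  exists x, parallel_multisplitting_iteration M N E b x0 x.
Proof.
move=> Mu.
pose f (z : 'cV[C]_n) := \sum_k E k *m (invmx (M k) *m (N k *m z + b)).
exists (fun i => iter i f x0); split=> // i.
exists (fun k => invmx (M k) *m (N k *m iter i f x0 + b)).
by split=> // k; rewrite mulKVmx.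
Qed.

End Definitions.

(* Main.v *)
(* Let H be the Hermitian part of A and T_k = 1 - M_k^-1 A. The identity
     A - T_k^* A T_k = V^* (M_k^* A^-* A + N_k) V,   V = M_k^-1 A,
   shows that extended P-regularity makes H - T_k^* H T_k positive definite, so
   each T_k strictly decreases x |-> x^* H x. This quadratic function is convex,
   hence it is also strictly decreased by T = \sum_k beta_k T_k, the error matrix
   of the iteration. With Q = H - T^* H T, the values x_i^* H x_i along the errors
   decrease and are nonnegative, so their increments x_i^* Q x_i tend to 0, and Q
   controls every entry of x_i. *)

Require Import Defs.
From HB Require Import structures.
From mathcomp Require Import all_boot all_order all_algebra.
From mathcomp Require Import complex.
From mathcomp Require Import ring.
From mathcomp Require Import all_classical all_reals all_analysis.

Set Implicit Arguments.
Unset Strict Implicit.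
Unset Printing Implicit Defensive.

Import Order.TTheory GRing.Theory Num.Theory.
Import numFieldNormedType.Exports.

Local Open Scope classical_set_scope.
Local Open Scope ring_scope.
Local Open Scope complex_scope.

(** * Adjoints and sesquilinear forms *)

Section HermitianForms.
Local Open Scope ring_scope.
Local Open Scope sesquilinear_scope.
Context {C : numClosedFieldType} {n : nat}.
Implicit Types (H X Y : 'M[C]_n) (u v w x : 'cV[C]_n).

Lemma adjmxM p q r (X : 'M[C]_(p, q)) (Y : 'M[C]_(q, r)) :
  (X *m Y)^t* = Y^t* *m X^t*.
Proof. by rewrite trmx_mul map_mxM. Qed.

Lemma adjmxD p q (X Y : 'M[C]_(p, q)) : (X + Y)^t* = X^t* + Y^t*.
Proof. by rewrite linearD map_mxD. Qed.

Lemma adjmxB p q (X Y : 'M[C]_(p, q)) : (X - Y)^t* = X^t* - Y^t*.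
Proof. by rewrite linearB map_mxB. Qed.

Lemma adjmxZ p q a (X : 'M[C]_(p, q)) : (a *: X)^t* = a^* *: X^t*.
Proof. by rewrite linearZ map_mxZ. Qed.

Lemma hermsymmxP X : reflect (X^t* = X) (X \is hermsymmx).
Proof. by rewrite is_hermitianmxE expr0 scale1r eq_sym; exact: eqP. Qed.

Definition mxform X u v : C := (u^t* *m X *m v) 0 0.

Lemma mxformD X Y u v : mxform (X + Y) u v = mxform X u v + mxform Y u v.
Proof. by rewrite /mxform mulmxDr mulmxDl mxE. Qed.

Lemma mxformB X Y u v : mxform (X - Y) u v = mxform X u v - mxform Y u v.
Proof. by rewrite /mxform mulmxBr mulmxBl [in LHS]mxE [in X in _ + X]mxE. Qed.

Lemma mxform_mul X Y u v :
  mxform (Y^t* *m X *m Y) u v = mxform X (Y *m u) (Y *m v).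
Proof. by rewrite /mxform adjmxM !mulmxA. Qed.

Lemma mxformDr X u v w : mxform X u (v + w) = mxform X u v + mxform X u w.
Proof. by rewrite /mxform mulmxDr mxE. Qed.

Lemma mxformDl X u v w : mxform X (u + v) w = mxform X u w + mxform X v w.
Proof. by rewrite /mxform adjmxD !mulmxDl mxE. Qed.

Lemma mxformZr X u a v : mxform X u (a *: v) = a * mxform X u v.
Proof. by rewrite /mxform -scalemxAr mxE. Qed.

Lemma mxformZl X u a v : mxform X (a *: u) v = a^* * mxform X u v.
Proof. by rewrite /mxform adjmxZ -!scalemxAl mxE. Qed.

Lemma mxformBr X u v w : mxform X u (v - w) = mxform X u v - mxform X u w.
Proof. by rewrite -scaleN1r mxformDr mxformZr mulN1r. Qed.

Lemma mxformBl X u v w : mxform X (u - v) w = mxform X u w - mxform X v w.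
Proof. by rewrite -scaleN1r mxformDl mxformZl rmorphN1 mulN1r. Qed.

Lemma mxform_suml X m (u : 'I_m -> 'cV[C]_n) v :
  mxform X (\sum_k u k) v = \sum_k mxform X (u k) v.
Proof.
apply: (big_morph (fun w => mxform X w v)) => [w1 w2|]; first exact: mxformDl.
by rewrite -(scale0r 0) mxformZl rmorph0 mul0r.
Qed.

Lemma mxform_sumr X u m (v : 'I_m -> 'cV[C]_n) :
  mxform X u (\sum_k v k) = \sum_k mxform X u (v k).
Proof.
apply: (big_morph (mxform X u)) => [w1 w2|]; first exact: mxformDr.
by rewrite /mxform mulmx0 mxE.
Qed.

Lemma mxform_adj X u v : mxform (X^t*) u v = (mxform X v u)^*.
Proof.
transitivity (((v^t* *m X *m u)^t*) 0 0); last by rewrite 2!mxE.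
by rewrite !adjmxM trmxCK mulmxA.
Qed.

Lemma mxformC H u v : H \is hermsymmx -> mxform H u v = (mxform H v u)^*.
Proof. by move=> /hermsymmxP Hh; rewrite -{1}Hh mxform_adj. Qed.

Lemma mxform_hermitian_part X u v :
  mxform (hermitian_part X) u v = 2^-1 * (mxform X u v + (mxform X v u)^*).
Proof.
by rewrite -mxform_adj /mxform -scalemxAr -scalemxAl mxE mulmxDr mulmxDl mxE.
Qed.

Lemma hermitian_part_hermsym X : hermitian_part X \is hermsymmx.
Proof.
apply/hermsymmxP.
by rewrite adjmxZ fmorphV rmorph_nat adjmxD trmxCK addrC.
Qed.

(** * Positivity of Hermitian forms *)

Lemma hermitian_posdef_ge0 H u : hermitian_posdef H -> 0 <= mxform H u u.
Proof.
move=> [_ Hpos]; have [->|u0] := eqVneq u 0; last exact/ltW/Hpos.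
by rewrite /mxform mulmx0 mxE.
Qed.

(** A left null vector [v] would make the form of the Hermitian part vanish at the nonzero column
    [v^t*]. *)
Lemma posdef_unitmx X : posdef X -> X \in unitmx.
Proof.
move=> [_ Xpos]; rewrite unitmxE unitfE; apply/det0P => -[v v0 vX].
have vt0 : v^t* != 0.
  by apply: contraNneq v0 => vt0; rewrite -[v]trmxCK vt0 trmx0 map_mx0.
have := Xpos _ vt0.
rewrite -/(mxform _ _ _) mxform_hermitian_part /mxform trmxCK vX mul0mx mxE.
by rewrite rmorph0 addr0 mulr0 ltxx.
Qed.

Lemma hermitian_posdef_unitmx H : hermitian_posdef H -> H \in unitmx.
Proof.
move=> [Hh Hpos]; apply: posdef_unitmx.
(* A Hermitian matrix is its own Hermitian part. *)
suff -> : posdef H = hermitian_posdef H by [].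
rewrite /posdef /hermitian_part (hermsymmxP _ Hh) -mulr2n -[H *+ 2]scaler_nat scalerA.
by rewrite mulVf ?pnatr_eq0// scale1r.
Qed.

(* Cauchy-Schwarz for the form of H, between x and H^-1 e_j. *)
Lemma hermitian_posdef_entry_bound H (j : 'I_n) : hermitian_posdef H ->
  exists2 K, 0 < K & forall x, `|x j 0| ^+ 2 <= K * mxform H x x.
Proof.
move=> Hpd; have [Hh Hpos] := Hpd; have Hu := hermitian_posdef_unitmx Hpd.
pose u : 'cV[C]_n := invmx H *m delta_mx j 0.
have ux x : mxform H u x = x j 0.
  rewrite /mxform -{1}(hermsymmxP _ Hh) -adjmxM /u mulKVmx// trmx_delta.
  by rewrite map_delta_mx -rowE mxE.
have u0 : u != 0.
  apply/eqP => /(congr1 (mulmx H)); rewrite mulKVmx// mulmx0 => /matrixP/(_ j 0).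
  by rewrite !mxE !eqxx => /eqP; rewrite oner_eq0.
have d0 : 0 < mxform H u u := Hpos _ u0.
exists (mxform H u u) => // x.
have := hermitian_posdef_ge0 (x - (mxform H u x / mxform H u u) *: u) Hpd.
rewrite mxformBl !mxformBr !mxformZl !mxformZr (mxformC x u Hh) rmorphM fmorphV.
rewrite /= -(mxformC u u Hh) normCK -(ux x).
set c := mxform H u x; set d := mxform H u u in d0 *; move=> h.
rewrite -subr_ge0; have := mulr_ge0 (ltW d0) h.
congr (0 <= _); field; exact: lt0r_neq0.
Qed.

(** The gap between the two sides is the weighted variance of the [v k] about their mean [w], a sum
    of nonnegative terms. *)
Lemma mxform_convex H m (beta : 'I_m -> C) (v : 'I_m -> 'cV[C]_n) :
    (forall u, 0 <= mxform H u u) ->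
    (forall k, 0 <= beta k) -> \sum_k beta k = 1 ->
  mxform H (\sum_k beta k *: v k) (\sum_k beta k *: v k)
    <= \sum_k beta k * mxform H (v k) (v k).
Proof.
move=> H0 b0 b1; set w := \sum_k _; rewrite -subr_ge0.
have : 0 <= \sum_k beta k * mxform H (v k - w) (v k - w).
  by apply: sumr_ge0 => k _; rewrite mulr_ge0.
(* Both cross terms of the variance reduce to the form at [w]. In the conjugate-linear slot, a
   nonnegative [beta k] equals its own conjugate. *)
have Sl : \sum_k beta k * mxform H (v k) w = mxform H w w.
  rewrite [in RHS]/w mxform_suml; apply: eq_bigr => k _.
  by rewrite mxformZl geC0_conj.
have Sr : \sum_k beta k * mxform H w (v k) = mxform H w w.
  by rewrite [in RHS]/w mxform_sumr; apply: eq_bigr => k _; rewrite mxformZr.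
congr (0 <= _).
under eq_bigr do rewrite mxformBl !mxformBr opprB !mulrDr !mulrN.
rewrite !big_split /= !sumrN Sl Sr -mulr_suml b1 mul1r.
by ring.
Qed.

(** * Energy decrease under splittings and their averages *)

(** Here [x - v] plays the role of T_k x, expressed without inverting [M]. Replacing [N] by [M - A]
    and [M *m v] by [A *m x] turns both sides into x^* A v + v^* A x - v^* A v. *)
Lemma splitting_form_decrease (A M N : 'M[C]_n) x v :
    A \in unitmx -> A = M - N -> M *m v = A *m x ->
  mxform A x x - mxform A (x - v) (x - v)
    = mxform (M^t* *m (invmx A)^t* *m A + N) v v.
Proof.
move=> Au AMN Mv.
have -> : N = M - A by rewrite AMN opprB addrC subrK.
have E1 : mxform (M^t* *m (invmx A)^t* *m A) v v = mxform A x v.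
  by rewrite /mxform !mulmxA -adjmxM Mv -adjmxM mulKmx.
have E2 : mxform M v v = mxform A v x by rewrite /mxform -mulmxA Mv mulmxA.
by rewrite mxformD mxformB E1 E2 mxformBl !mxformBr; ring.
Qed.

(** At equal arguments, the form of a Hermitian part is the real part of the original form, so this
    is the real part of [splitting_form_decrease]; invertibility of [A] makes [v] nonzero. *)
Lemma extended_P_regular_decrease (A M N : 'M[C]_n) x v :
    A \in unitmx -> extended_P_regular_splitting A M N ->
    x != 0 -> M *m v = A *m x ->
  mxform (hermitian_part A) (x - v) (x - v) < mxform (hermitian_part A) x x.
Proof.
move=> Au [AMN Mu [_ Ppos]] x0 Mv.
have v0 : v != 0.
  apply: contraNneq x0 => v0; move: Mv; rewrite v0 mulmx0 => Ax.
  by rewrite -(mulKmx Au x) -Ax mulmx0.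
rewrite -subr_gt0; have := Ppos v v0.
rewrite -/(mxform _ _ _) !mxform_hermitian_part.
rewrite -(splitting_form_decrease Au AMN Mv).
by congr (0 < _); rewrite rmorphB /=; ring.
Qed.

(** The error propagation matrix; it is the average of the T_k when the weights sum to 1. *)
Definition multisplitting_mx m (A : 'M[C]_n) (M : 'I_m -> 'M[C]_n)
    (beta : 'I_m -> C) : 'M[C]_n :=
  1%:M - \sum_k beta k *: (invmx (M k) *m A).

(** A Stein (discrete Lyapunov) condition: [T] strictly shrinks every nonzero vector in the norm of
    the Hermitian part of [A]. Convexity reduces it to the decrease under each T_k, whose value at
    [x] is [v k] below. *)
Lemma multisplitting_stein m (A : 'M[C]_n) (M N : 'I_m -> 'M[C]_n)
    (beta : 'I_m -> C) (T := multisplitting_mx A M beta) :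
    posdef A -> (forall k, extended_P_regular_splitting A (M k) (N k)) ->
    (forall k, 0 <= beta k) -> \sum_k beta k = 1 ->
  hermitian_posdef
    (hermitian_part A - T^t* *m hermitian_part A *m T).
Proof.
move=> Apd P b0 b1; set H := hermitian_part A.
have Hh : H^t* = H by apply/hermsymmxP/hermitian_part_hermsym.
split=> [|x x0].
  by apply/hermsymmxP; rewrite adjmxB !adjmxM trmxCK Hh mulmxA.
pose v k := x - invmx (M k) *m A *m x.
have Tx : T *m x = \sum_k beta k *: v k.
  rewrite mulmxBl mul1mx mulmx_suml.
  under [RHS]eq_bigr do rewrite scalerBr.
  rewrite big_split /= -scaler_suml b1 scale1r sumrN.
  by congr (_ - _); apply: eq_bigr => k _; rewrite -scalemxAl.
rewrite -/(mxform _ _ _) mxformB mxform_mul subr_gt0 Tx.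
have Hge u := hermitian_posdef_ge0 u Apd.
apply: le_lt_trans (mxform_convex v Hge b0 b1) _.
rewrite -[ltRHS]mul1r -b1 mulr_suml -subr_gt0 -sumrB.
have dec k : 0 < mxform H x x - mxform H (v k) (v k).
  rewrite subr_gt0; have [_ Mu _] := P k.
  apply: (extended_P_regular_decrease (posdef_unitmx Apd) (P k)) => //.
  by rewrite -mulmxA mulKVmx.
under eq_bigr do rewrite -mulrBr.
have bd k : 0 <= beta k * (mxform H x x - mxform H (v k) (v k)).
  by rewrite mulr_ge0// ltW.
(* Averaging keeps the inequality strict because some weight is positive: otherwise all would
   vanish, against their sum being 1. *)
rewrite lt0r sumr_ge0 ?andbT; last by move=> k _; exact: bd.
rewrite psumr_neq0//.
have /eqP := b1; apply: contraTT => /hasPn none.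
rewrite big1 ?(eq_sym 0) ?oner_eq0// => k _; apply/eqP.
have := none k; rewrite mem_index_enum => /(_ isT) /=.
by rewrite pmulr_lgt0// lt0r b0 andbT negbK.
Qed.

End HermitianForms.

(** * Convergence of the error iteration *)

Section Convergence.
Local Open Scope ring_scope.
Local Open Scope sesquilinear_scope.
Variable R : realType.

(** Monotone convergence applies to the real parts, and the increments are differences of two
    sequences with the same limit. The tolerance lies in [R[i]], as do the radii of balls in the
    final convergence proof. *)
Lemma nonincreasing_increment_cvg0 (h : nat -> R[i]) :
    (forall i, 0 <= h i) -> (forall i, h i.+1 <= h i) ->
  forall e, 0 < e -> \forall i \near \oo, h i - h i.+1 < e.
Proof.
move=> h0 hd e e0.
have Rh_cvg : cvgn (fun i => complex.Re (h i)).
  apply: nonincreasing_is_cvgn.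
    by apply/nonincreasing_seqP => i; have := hd i; rewrite lecE => /andP[].
  by exists 0 => _ [i _ <-]; have := h0 i; rewrite lecE => /andP[].
have dcvg : complex.Re (h i) - complex.Re (h i.+1) @[i --> \oo] --> (0 : R).
  rewrite -(subrr (limn (fun i => complex.Re (h i)))).
  by apply: cvgB => //; rewrite (cvg_shiftS (fun i => complex.Re (h i))).
have := e0; rewrite ltcE => /andP[Ime Ree].
(* The order on [R[i]] also requires equal imaginary parts; those of [e] and of the increment are
   both 0. *)
near=> i; rewrite ltcE; apply/andP; split.
  have := hd i; have := Ime; rewrite lecE !raddfB /= => /eqP -> /andP[/eqP -> _].
  by rewrite subrr.
rewrite raddfB /=; near: i.
exact: (cvgr_lt 0 dcvg).
Unshelve. all: by end_near. Qed.

Lemma stein_iterates_cvg0 n (H T : 'M[R[i]]_n) (x : nat -> 'cV[R[i]]_n) :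
    hermitian_posdef H -> hermitian_posdef (H - T^t* *m H *m T) ->
    (forall i, x i.+1 = T *m x i) ->
  forall j e, 0 < e -> \forall i \near \oo, `|x i j 0| < e.
Proof.
move=> Hpd Qpd xS j e e0.
have [K K0 xK] := hermitian_posdef_entry_bound j Qpd.
have QE i : mxform (H - T^t* *m H *m T) (x i) (x i)
    = mxform H (x i) (x i) - mxform H (x i.+1) (x i.+1).
  by rewrite mxformB mxform_mul -xS.
have hd i : mxform H (x i.+1) (x i.+1) <= mxform H (x i) (x i).
  by rewrite -subr_ge0 -QE; exact: hermitian_posdef_ge0.
(* Once the increment is below this threshold, the entry bound gives a squared modulus below
   [e ^+ 2]. *)
have eK0 : 0 < e ^+ 2 / K by rewrite divr_gt0// exprn_gt0.
have := nonincreasing_increment_cvg0 (fun i => hermitian_posdef_ge0 _ Hpd) hd eK0.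
apply: filterS => i; rewrite -QE ltr_pdivlMr// mulrC => lt_e.
by rewrite -(@ltr_pXn2r _ 2)// ?nnegrE// ?ltW//; exact: le_lt_trans (xK _) lt_e.
Qed.

Lemma multisplitting_error n m (A : 'M[R[i]]_n) (M N E : 'I_m -> 'M[R[i]]_n)
    (beta : 'I_m -> R[i]) (b x0 xs : 'cV[R[i]]_n) (x : nat -> 'cV[R[i]]_n) :
    (forall k, A = M k - N k) -> (forall k, M k \in unitmx) ->
    (forall k, E k = (beta k)%:M) -> \sum_k E k = 1%:M -> A *m xs = b ->
    parallel_multisplitting_iteration M N E b x0 x ->
  forall i, x i.+1 - xs = multisplitting_mx A M beta *m (x i - xs).
Proof.
move=> AMN Mu EB E1 Axs [_ xS] i.
have [y [My ->]] := xS i.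
(* Substituting [N k = M k - A] and [b = A *m xs] shows that each local solve corrects [x i] by a
   multiple of the current error. *)
have yE k : y k = x i - invmx (M k) *m A *m (x i - xs).
  apply: (can_inj (mulKmx (Mu k))).
  rewrite My mulmxBr -!mulmxA mulKVmx// mulmxBr Axs (AMN k) mulmxBl.
  by rewrite !opprB addrCA (addrC (M k *m _)) subrK addrC.
under eq_bigr do rewrite yE mulmxBr.
rewrite big_split /= -mulmx_suml E1 mul1mx sumrN.
rewrite mulmxBl mul1mx addrAC; congr (_ - _).
rewrite mulmx_suml; apply: eq_bigr => k _.
by rewrite EB mul_scalar_mx scalemxAl.
Qed.

End Convergence.

Theorem theorem3p4 (R : realType) (n m : nat) (A : 'M[R[i]]_n)
    (M N E : 'I_m -> 'M[R[i]]_n) (beta : 'I_m -> R[i])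
    (hA : nonhermitian_posdef A)
    (hMNE : multisplitting A M N E)
    (hE : forall k, E k = (beta k)%:M)
    (hP : forall k, extended_P_regular_splitting A (M k) (N k))
    (b : 'cV[R[i]]_n) :
  exists xs : 'cV[R[i]]_n,
    [/\ A *m xs = b,
        forall z : 'cV[R[i]]_n, A *m z = b -> z = xs
      & forall (x0 : 'cV[R[i]]_n) (x : nat -> 'cV[R[i]]_n),
          parallel_multisplitting_iteration M N E b x0 x ->
          x i @[i --> \oo] --> xs].
Proof.
have [_ Apd] := hA; have [AMN Mu _ E0 E1] := hMNE.
have Au := posdef_unitmx Apd.
exists (invmx A *m b).
split=> [|z <-|x0 x xit]; [exact: mulKVmx|by rewrite mulKmx|].
have xS := multisplitting_error AMN Mu hE E1 (mulKVmx Au b) xit.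
set xs := invmx A *m b in xS *.
have cvg0 (j : 'I_n) (e : R[i]) : 0 < e ->
    \forall i \near \oo, `|(x i - xs) j 0| < e.
  (* The weights are read off the diagonal entry [j] of [E k], so an index is fixed first: for
     [n = 0] the matrices say nothing about [beta], but there is also no entry to bound. *)
  have b0 k : 0 <= beta k by have := E0 k j j; rewrite hE mxE eqxx.
  have b1 : \sum_k beta k = 1.
    have /matrixP/(_ j j) := E1; rewrite summxE mxE eqxx mulr1n => <-.
    by apply: eq_bigr => k _; rewrite hE mxE eqxx.
  exact: (stein_iterates_cvg0 Apd (multisplitting_stein Apd hP b0 b1) xS).
apply/cvg_ballP => e e0.
(* Balls of matrices are entrywise, so the finitely many eventual bounds are made simultaneous. *)
have : \forall i \near \oo, forall j, `|(x i - xs) j 0| < e.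
  by apply: filter_forall => j; exact: cvg0.
apply: filterS => i xe; split=> // j k; rewrite (ord1 k).
by have := xe j; rewrite !mxE distrC.
Qed.
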